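(* Let $\mu:\Theta\to\mathbb{R}^{d_t}$ be a function on a parameter set $\Theta$, with image $\mu(\Theta)$, and let $\phi$ be an $\mathbb{R}^{d_x}$-valued function on a subset of $\mathbb{R}^{d_t}$. For a set $\mathscr{T}\subset\mathbb{R}^{d_t}$ and $\epsilon>0$ write $$\mathscr{T}^\epsilon=\{t:\ \|t-\mu\|\le\epsilon \text{ for some } \mu\in\mathscr{T}\}.$$ Suppose that $\mu(\Theta)$ is compact, that $\phi$ is everywhere continuously differentiable on $\mu(\Theta)^\epsilon$ for some $\epsilon>0$, and that the derivative matrix $D(\mu)=\frac{\partial\phi}{\partial m}(\mu)$ (of size $d_x\times d_t$) has full row rank for all $\mu\in\mu(\Theta)$. For $m\in\mu(\Theta)$ let $$\Delta(t,m)=\frac{1}{\|t-m\|}\left\|E(m)\cdot\big(\phi(t)-\phi(m)-D(m)\cdot(t-m)\big)\right\|,\qquad E(m)=\operatorname{diag}(\|D_k(m)\|)^{-1}.$$ Then there exists a function $\widetilde{\delta}:(0,\infty)\to[0,\infty]$ with $\lim_{\epsilon'\to 0}\widetilde{\delta}(\epsilon')=0$ such that $$\Delta(t,m)\le\widetilde{\delta}(\|t-m\|)$$ for all $m\in\mu(\Theta)$ and all $t\ne m$ in the domain of $\phi$.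
   Context: $\|D_k(m)\|$ denotes the Euclidean norm of the $k$th row of the matrix $D(m)$, so $E(m)$ is the $d_x\times d_x$ diagonal matrix whose $k$th diagonal entry is $1/\|D_k(m)\|$. *)

(* Defs.v *)
From HB Require Import structures.
From mathcomp Require Import all_boot all_order all_algebra.
From mathcomp Require Import all_classical all_reals all_analysis.
Import Order.TTheory GRing.Theory Num.Theory numFieldNormedType.Exports.

Set Implicit Arguments.
Unset Strict Implicit.
Unset Printing Implicit Defensive.

Local Open Scope classical_set_scope.
Local Open Scope ring_scope.

(* The library norm on matrices is the max norm, hence this definition; it is
   only applied to row and column vectors. *)
Definition enorm (R : realType) (p q : nat) (v : 'M[R]_(p, q)) : R :=
  Num.sqrt (\sum_i \sum_j v i j ^+ 2).

Definition thickening (R : realType) (d : nat) (T : set 'rV[R]_d) (eps : R) :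
    set 'rV[R]_d :=
  [set t | exists2 m, T m & enorm (t - m) <= eps].

(* The library Jacobian acts on row vectors by right multiplication; its
   transpose has entries (k, j) equal to the partial derivative of phi_k with
   respect to m_j. *)
Definition Dmx (R : realType) (dt dx : nat) (phi : 'rV[R]_dt -> 'rV[R]_dx)
    (m : 'rV[R]_dt) : 'M[R]_(dx, dt) :=
  (jacobian phi m)^T.

Definition C1_on (R : realType) (dt dx : nat) (phi : 'rV[R]_dt -> 'rV[R]_dx)
    (S : set 'rV[R]_dt) : Prop :=
  (forall t, S t -> differentiable phi t) /\ {within S, continuous (Dmx phi)}.

Definition Emx (R : realType) (dt dx : nat) (phi : 'rV[R]_dt -> 'rV[R]_dx)
    (m : 'rV[R]_dt) : 'M[R]_dx :=
  diag_mx (\row_k (enorm (row k (Dmx phi m)))^-1).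

Definition Delta (R : realType) (dt dx : nat) (phi : 'rV[R]_dt -> 'rV[R]_dx)
    (t m : 'rV[R]_dt) : R :=
  (enorm (t - m))^-1 *
  enorm (Emx phi m *m ((phi t - phi m)^T - Dmx phi m *m (t - m)^T)).

(* Main.v *)
Require Import Defs.
From HB Require Import structures.
From mathcomp Require Import all_boot all_order all_algebra.
From mathcomp Require Import all_classical all_reals all_analysis.
From mathcomp Require Import ring.
Import Order.TTheory GRing.Theory Num.Theory numFieldNormedType.Exports.

(** The smallest candidate for the modulus is
      delta(r) = sup { Delta(t, m) : m in mu(Theta), t in A, |t - m| = r },
    with 0 thrown in so that it is nonnegative even where there is no pair
    (t, m) at distance r.  The bound and the sign are then automatic, and what
    has to be shown is that Delta(t, m) tends to 0 with |t - m|, uniformly in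
    m over the compact image of mu.

    By the mean value theorem on the segment from m to t, the k-th component of
    the remainder phi(t) - phi(m) - D(m)(t - m) equals the k-th component of
    (D(xi_k) - D(m))(t - m) for a point xi_k of the segment.  Hence
      Delta(t, m) <= d_t * eta * sum_k 1 / |D_k(m)|
    as soon as D varies by at most eta along the segment: this is
    [Delta_le_osc].  Around a fixed m0 in the image of mu, which is interior to
    the thickening, D is continuous, so eta can be made small; full row rank
    makes every row of D(m0) nonzero, so the sum of the inverse row norms is
    continuous at m0 and thus bounded near m0.  This gives the local uniform
    estimate [Delta_le_near], and the near-covering form of compactness turns it
    into the uniform estimate [Delta_le_uniform]. *)

Set Implicit Arguments.
Unset Strict Implicit.
Unset Printing Implicit Defensive.

Local Open Scope classical_set_scope.
Local Open Scope ring_scope.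

(** * The Euclidean norm and the max norm *)

Section enorm.
Context (R : realType) (p q : nat).
Implicit Types v : 'M[R]_(p, q).

Lemma enorm_ge0 v : 0 <= enorm v.
Proof. exact: sqrtr_ge0. Qed.

Lemma le_entry_enorm v i j : `|v i j| <= enorm v.
Proof.
rewrite -sqrtr_sqr /enorm ler_sqrt; last first.
  by apply: sumr_ge0 => ? _; apply: sumr_ge0 => ? _; exact: sqr_ge0.
rewrite (bigD1 i)//= (bigD1 j)//= -addrA lerDl addr_ge0//.
  by apply: sumr_ge0 => ? _; exact: sqr_ge0.
by apply: sumr_ge0 => ? _; apply: sumr_ge0 => ? _; exact: sqr_ge0.
Qed.

Lemma enorm_gt0 v : v != 0 -> 0 < enorm v.
Proof.
move=> v0; rewrite lt_neqAle enorm_ge0 andbT; apply: contra v0 => /eqP e0.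
apply/eqP/matrixP => i j; rewrite mxE; apply/normr0_eq0/le_anti.
by rewrite normr_ge0 e0 le_entry_enorm.
Qed.

Lemma sum_sqr_le (I : finType) (F : I -> R) :
  (forall i, 0 <= F i) -> \sum_i F i ^+ 2 <= (\sum_i F i) ^+ 2.
Proof.
move=> F0; rewrite expr2 mulr_suml ler_sum// => i _.
by rewrite expr2 ler_wpM2l// (bigD1 i)//= lerDl sumr_ge0.
Qed.

Lemma enorm_le_sum v : enorm v <= \sum_i \sum_j `|v i j|.
Proof.
have s0 i : 0 <= \sum_j `|v i j| by exact: sumr_ge0.
rewrite -[leRHS]ger0_norm ?sumr_ge0// -sqrtr_sqr /enorm ler_sqrt ?sqr_ge0//.
apply: le_trans (sum_sqr_le s0); apply: ler_sum => i _.
rewrite -(eq_bigr _ (fun j _ => real_normK (num_real (v i j)))).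
by apply: sum_sqr_le => j.
Qed.

Lemma le_entry_mx_norm v i j : `|v i j| <= `|v|.
Proof.
by rewrite [leRHS]/Num.norm/= mx_normrE; apply/bigmax_geP; right; exists (i, j).
Qed.

Lemma mx_norm_le_enorm v : `|v| <= enorm v.
Proof.
rewrite [leLHS]/Num.norm/= mx_normrE; apply/bigmax_leP; split=> [|ij _].
  exact: enorm_ge0.
exact: le_entry_enorm.
Qed.

Lemma continuous_enorm_row k :
  continuous (fun v : 'M[R]_(p, q) => enorm (row k v)).
Proof.
have -> : (fun v : 'M[R]_(p, q) => enorm (row k v)) =
    (fun v => Num.sqrt (\sum_j v k j ^+ 2)).
  apply/funext => v; rewrite /enorm big_ord1.
  by congr Num.sqrt; apply: eq_bigr => j _; rewrite mxE.
suff cs : continuous (fun v : 'M[R]_(p, q) => \sum_j v k j ^+ 2).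
  by move=> v; apply: continuous_comp; [exact: cs|exact: sqrt_continuous].
apply: continuous_big => [|j _ v]; first exact: add_continuous.
apply: (@continuous_comp _ _ _ (fun v => v k j) (fun x : R => x ^+ 2)).
  exact: coord_continuous.
exact: exprn_continuous.
Qed.

End enorm.

Lemma le_entry_mulmx (R : realType) p q (D : 'M[R]_(p, q)) (v : 'rV[R]_q) k :
  `|(D *m v^T) k 0| <= q%:R * `|D| * enorm v.
Proof.
rewrite mxE (le_trans (ler_norm_sum _ _ _))//.
apply: (@le_trans _ _ (\sum_(j < q) `|D| * enorm v)).
  apply: ler_sum => j _; rewrite normrM ler_pM//; first exact: le_entry_mx_norm.
  by rewrite mxE le_entry_enorm.
by rewrite sumr_const card_ord -[leLHS]mulr_natl mulrA.
Qed.

(** Neighbourhoods are those of the max norm, whereas [thickening] is Euclidean;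
    the two norms differ at most by the factor [d]. *)
Lemma nbhs_thickening (R : realType) d (T : set 'rV[R]_d) (eps : R) m :
  0 < eps -> T m -> nbhs m (thickening T eps).
Proof.
(* d.+1 rather than d keeps the radius positive in dimension 0. *)
move=> eps0 Tm; have e0 : 0 < eps / d.+1%:R by rewrite divr_gt0.
apply/nbhs_ballP; exists (eps / d.+1%:R) => //= y.
rewrite -ball_normE/= distrC => /ltW ye; exists m => //.
apply: (le_trans (enorm_le_sum _)); rewrite big_ord1.
apply: (@le_trans _ _ (\sum_(j < d) eps / d.+1%:R)).
  by apply: ler_sum => j _; exact: le_trans (le_entry_mx_norm _ _ _) ye.
rewrite sumr_const card_ord -[leLHS]mulr_natr mulrAC ler_pdivrMr//.
by rewrite ler_wpM2l ?ler_nat// ltW.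
Qed.

(** * Inverse row norms of full-rank matrices *)

Lemma row_free_enorm_gt0 (R : realType) p q (D : 'M[R]_(p, q)) k :
  row_free D -> 0 < enorm (row k D).
Proof.
move=> freeD; apply: enorm_gt0; rewrite rowE mulmx_free_eq0//.
by apply/eqP => /matrixP/(_ 0 k)/eqP; rewrite !mxE !eqxx/= oner_eq0.
Qed.

Definition sum_inv_row_norms (R : realType) p q (D : 'M[R]_(p, q)) : R :=
  \sum_k (enorm (row k D))^-1.

Lemma cvg_sum_inv_row_norms (R : realType) (T : Type) (F : set_system T) p q
    (D : T -> 'M[R]_(p, q)) (D0 : 'M[R]_(p, q)) :
  Filter F -> row_free D0 -> D x @[x --> F] --> D0 ->
  sum_inv_row_norms (D x) @[x --> F] --> sum_inv_row_norms D0.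
Proof.
move=> FF freeD cD; rewrite /sum_inv_row_norms.
apply: cvg_big => [|k _]; first exact: add_continuous.
apply: cvgV; first by rewrite gt_eqF// row_free_enorm_gt0.
exact: (@cvg_comp _ _ _ D (fun N => enorm (row k N)) _ _ _ cD
  (@continuous_enorm_row R p q k D0)).
Qed.

(** * The mean value estimate *)

Instance is_diff_coord (R : realType) p q (M : 'M[R]_(p, q)) i j :
  is_diff M (fun N => N i j : R) (fun N => N i j).
Proof.
have @f : {linear 'M[R]_(p, q) -> R}.
  by exists (fun N : 'M[R]_(_, _) => N i j); do 2![eexists]; do ?[constructor];
     rewrite ?mxE// => ? *; rewrite ?mxE//; move=> ?; rewrite !mxE.
apply: DiffDef; first exact: differentiable_coord.
by rewrite -[LHS]/('d f M : _ -> _) diff_lin//; exact: coord_continuous.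
Qed.

Section bound.
Context (R : realType) (dt dx : nat) (phi : 'rV[R]_dt -> 'rV[R]_dx).
Implicit Types m t v : 'rV[R]_dt.

Lemma is_derive_segment m v k (s : R) : differentiable phi (m + s *: v) ->
  is_derive s 1 (fun h : R => phi (m + h *: v) 0 k : R)
    ((Dmx phi (m + s *: v) *m v^T) k 0).
Proof.
move=> dphi.
have dl : is_diff s (fun h : R => m + h *: v) ( *:%R^~ v).
  by have := is_diffD (is_diff_cst m s) (is_diff_scalel s v); rewrite add0r.
have dp := is_diff_comp dl (DiffDef (Phantom _ _) dphi erefl).
have dc := is_diff_comp dp (is_diff_coord _ 0 k).
have dd : differentiable (fun h : R => phi (m + h *: v) 0 k : R) s.
  by have := @ex_diff _ _ _ _ _ _ _ dc.
split; first exact: diff_derivable.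
rewrite deriveE//.
have := @diff_val _ _ _ _ _ _ _ dc => /(congr1 (fun f : R -> R => f 1)) /= ->.
by rewrite scale1r -trmx_mul mxE /jacobian mul_rV_lin1.
Qed.

(** The mean value theorem holds for scalar functions only, so the intermediate
    point depends on the component [k]. *)
Lemma MVT_coord m t k :
  (forall s : R, 0 <= s <= 1 -> differentiable phi (m + s *: (t - m))) ->
  exists2 s : R, 0 <= s <= 1 &
    (phi t - phi m) 0 k = (Dmx phi (m + s *: (t - m)) *m (t - m)^T) k 0.
Proof.
move=> dphi; pose g (s : R) : R := phi (m + s *: (t - m)) 0 k.
have dg (s : R) : 0 <= s <= 1 ->
    is_derive s 1 g ((Dmx phi (m + s *: (t - m)) *m (t - m)^T) k 0).
  by move=> s01; apply/is_derive_segment/dphi.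
have cg : {within `[0, 1], continuous g}.
  apply: derivable_within_continuous => s; rewrite in_itv /= => /dg dgs.
  exact: ex_derive.
have [|s] := @MVT_segment _ g
  (fun s => (Dmx phi (m + s *: (t - m)) *m (t - m)^T) k 0) _ _ ler01 _ cg.
  by move=> s; rewrite in_itv /= => /andP[s0 s1]; apply: dg; rewrite !ltW.
rewrite in_itv /= => s01; rewrite subr0 mulr1 /g scale1r scale0r addr0.
rewrite [m + _]addrC subrK => gE.
by exists s => //; rewrite -gE !mxE.
Qed.

(** The inverse of [enorm (t - m)] in [Delta] cancels the factor
    [enorm (t - m)] of the remainder, and the Euclidean norm of the [dx]
    components is bounded by their sum, so that each row contributes its own
    inverse norm. *)
Lemma Delta_le_osc m t (eta : R) :
  (forall s : R, 0 <= s <= 1 -> differentiable phi (m + s *: (t - m))) ->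
  (forall s : R, 0 <= s <= 1 ->
    `|Dmx phi (m + s *: (t - m)) - Dmx phi m| <= eta) ->
  t != m -> Delta phi t m <= dt%:R * eta * sum_inv_row_norms (Dmx phi m).
Proof.
move=> dphi osc tm; have tm0 : 0 < enorm (t - m) by rewrite enorm_gt0 ?subr_eq0.
rewrite /Delta ler_pdivrMl//; apply: (le_trans (enorm_le_sum _)).
rewrite /sum_inv_row_norms !mulr_sumr; apply: ler_sum => k _.
rewrite big_ord1 /Emx mul_diag_mx mxE normrM mxE.
rewrite ger0_norm ?invr_ge0 ?enorm_ge0//.
rewrite [leRHS]mulrA [leRHS]mulrC ler_wpM2l ?invr_ge0 ?enorm_ge0//.
have [s s01 sE] := MVT_coord k dphi.
have -> : ((phi t - phi m)^T - Dmx phi m *m (t - m)^T) k 0 =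
    ((Dmx phi (m + s *: (t - m)) - Dmx phi m) *m (t - m)^T) k 0.
  by rewrite mulmxBl [LHS]mxE [RHS]mxE -sE [X in X + _]mxE.
rewrite (le_trans (le_entry_mulmx _ _ _))// [leRHS]mulrC.
by rewrite ler_wpM2r ?enorm_ge0// ler_wpM2l// osc.
Qed.

(** * Uniformity over the compact set *)

(** The estimate is uniform in [m] near [m0], not only at [m0]: this is where
    continuity of the derivative, rather than differentiability, is used, and
    it is what lets compactness patch the local estimates together. *)
Lemma Delta_le_near m0 (e : R) : 0 < e ->
  (\forall m \near m0, differentiable phi m) -> {for m0, continuous (Dmx phi)} ->
  row_free (Dmx phi m0) ->
  \forall m \near m0 & r \near (0 : R)^'+,
    forall t, t != m -> enorm (t - m) <= r -> Delta phi t m <= e.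
Proof.
move=> e0 dphi cD freeD.
pose C := sum_inv_row_norms (Dmx phi m0) + 1.
have C0 : 0 < C.
  by rewrite ltr_wpDl// sumr_ge0// => k _; rewrite invr_ge0 enorm_ge0.
(* The final bound is dt * (2 * eta) * C: the derivative at two points that are
   each within eta of D(m0) differs by at most 2 * eta. *)
pose eta := e / (2 * dt.+1%:R * C).
have eta0 : 0 < eta by rewrite divr_gt0// !mulr_gt0.
have near_osc : \forall y \near m0, `|Dmx phi m0 - Dmx phi y| <= eta.
  by move/cvgrPdist_le: cD; apply.
have near_C : \forall y \near m0, sum_inv_row_norms (Dmx phi y) <= C.
  have := cvg_sum_inv_row_norms (nbhs_filter m0) freeD cD.
  move/cvgrPdist_le => /(_ _ ltr01); apply: filterS => y.
  by rewrite distrC ler_distl => /andP[].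
have /nbhs_ballP[d /= d0 good] : nbhs m0 [set y | [/\ differentiable phi y,
    `|Dmx phi m0 - Dmx phi y| <= eta &
    sum_inv_row_norms (Dmx phi y) <= C]].
  by apply: filterS3 dphi near_osc near_C.
have d20 : 0 < d / 2 by rewrite divr_gt0.
(* A segment of length at most d / 2 issued from the ball of radius d / 2 stays
   in the ball of radius d. *)
exists (ball m0 (d / 2), [set r | r < d / 2]).
  by split=> /=; [exact: nbhsx_ballx|exact: nbhs_right_lt].
move=> [m r] /= [m0m rd] t tm tmr.
have seg (s : R) : 0 <= s <= 1 -> ball m0 d (m + s *: (t - m)).
  move=> /andP[s0 s1]; rewrite -ball_normE /= opprD addrA.
  rewrite (le_lt_trans (ler_normB _ _))// (splitr d) ltr_leD//.
    by move: m0m; rewrite -ball_normE.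
  rewrite normrZ ger0_norm// (le_trans _ (ltW rd))// (le_trans _ tmr)//.
  by rewrite (le_trans _ (mx_norm_le_enorm _))// ler_piMl.
have mE : m = m + 0 *: (t - m) by rewrite scale0r addr0.
have /good[_ oscm Cm] : ball m0 d m.
  by rewrite mE; apply: seg; rewrite lexx ler01.
have tri (X Y Z : 'M[R]_(dx, dt)) :
    `|Z - X| <= eta -> `|Z - Y| <= eta -> `|X - Y| <= 2 * eta.
  move=> ZX ZY; rewrite mulr_natl mulr2n (le_trans (ler_distD Z _ _))//.
  by rewrite lerD// distrC.
have Dle : Delta phi t m <= dt%:R * (2 * eta) * sum_inv_row_norms (Dmx phi m).
  apply: Delta_le_osc => //.
  - by move=> s /seg/good[].
  - by move=> s /seg/good[_ osc _]; exact: tri osc oscm.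
apply: (le_trans Dle); apply: (@le_trans _ _ (dt%:R * (2 * eta) * C)).
  by rewrite ler_wpM2l// mulr_ge0// mulr_ge0// ltW.
have -> : dt%:R * (2 * eta) * C = dt%:R / dt.+1%:R * e.
  by rewrite /eta; field; rewrite nat1r pnatr_eq0 (gt_eqF C0).
by rewrite ler_piMl ?(ltW e0)// ler_pdivrMr// mul1r ler_nat.
Qed.

(** The near-covering form of compactness makes the threshold on [r] common to
    all points of [K]. *)
Lemma Delta_le_uniform (K S : set 'rV[R]_dt) (e : R) : 0 < e -> compact K ->
  (forall m, K m -> nbhs m S) -> C1_on phi S ->
  (forall m, K m -> row_free (Dmx phi m)) ->
  \forall r \near (0 : R)^'+, forall m t, K m -> t != m ->
    enorm (t - m) <= r -> Delta phi t m <= e.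
Proof.
move=> e0 /compact_near_coveringP cov KS [dphi cD] freeD.
have : \forall r \near (0 : R)^'+, K `<=`
    [set m | forall t, t != m -> enorm (t - m) <= r -> Delta phi t m <= e].
  apply: cov => m Km.
  have dphim : \forall y \near m, differentiable phi y.
    by apply: filterS (KS _ Km) => y; exact: dphi.
  have cDm : {for m, continuous (Dmx phi)}.
    have mS : (S°)%classic m by exact: KS.
    by have := cD m; rewrite /continuous_at -nbhs_subspace_interior.
  exact: Delta_le_near e0 dphim cDm (freeD _ Km).
by apply: filterS => r uni m t Km; exact: uni.
Qed.

End bound.

(* phi is total; A is its domain, and its values outside A do not occur in the
   conclusion. *)
Theorem theorem3 (R : realType) (dt dx : nat) (Theta : Type)
    (mu : Theta -> 'rV[R]_dt) (A : set 'rV[R]_dt)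
    (phi : 'rV[R]_dt -> 'rV[R]_dx)
    (mu_compact : compact (range mu))
    (phi_C1 : exists eps : R, [/\ 0 < eps,
       thickening (range mu) eps `<=` A &
       C1_on phi (thickening (range mu) eps)])
    (D_full_rank : forall m, range mu m -> row_free (Dmx phi m)) :
  exists delta : R -> \bar R,
    [/\ forall r : R, 0 < r -> (0 <= delta r)%E,
        delta r @[r --> 0^'+] --> 0%E &
        forall m t, range mu m -> A t -> t != m ->
          ((Delta phi t m)%:E <= delta (enorm (t - m)))%E].
Proof.
have [eps [eps0 _ phi1]] := phi_C1.
pose values (r : R) : set (\bar R) := [set 0%E] `|`
  [set x | exists m t, [/\ range mu m, A t, t != m, enorm (t - m) = r
                         & x = (Delta phi t m)%:E]].
pose delta r := ereal_sup (values r).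
have delta0 r : (0 <= delta r)%E by apply: ereal_sup_ubound; left.
have delta_le (e : R) : 0 < e -> \forall r \near (0 : R)^'+, (delta r <= e%:E)%E.
  move=> e0; have := Delta_le_uniform e0 mu_compact
    (fun m => @nbhs_thickening _ _ _ _ m eps0) phi1 D_full_rank.
  apply: filterS => r uni; apply: ge_ereal_sup => x [->|].
    by rewrite lee_fin ltW.
  move=> [m [t [Km _ tm tmr ->]]]; rewrite lee_fin.
  by apply: uni => //; rewrite tmr.
exists delta; split => [r _||m t Km At tm]; first exact: delta0.
- (* The bound by 1 makes delta finite near 0, where it can be compared with
     real numbers. *)
  have delta_fin r : (delta r <= 1)%E -> delta r \is a fin_num.
    by move=> d1; rewrite ge0_fin_numE// (le_lt_trans d1)// ltry.
  apply/fine_cvgP; split.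
    by apply: filterS (delta_le _ ltr01) => r /delta_fin.
  apply/cvgr0Pnorm_le => e e0.
  apply: filterS2 (delta_le _ ltr01) (delta_le _ e0) => r /delta_fin dr dre /=.
  by rewrite ger0_norm ?fine_ge0// -lee_fin fineK.
- by apply: ereal_sup_ubound; right; exists m, t.
Qed.
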